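(* Consider a stationary $GI/GI/1$ queue with load $\rho<1$ and light-tailed service times distributed as $B$, with right endpoint $x_B=\sup\{x:\mathbb{P}\{B>x\}>0\}$. Let $$y^*=\sup\{y:\gamma_p^y\ge\gamma_w\},$$ where $\gamma_w$ is the decay rate of the steady-state workload at arrival epochs and $\gamma_p^y$ is the decay rate of the busy period in the queue with service times $B^y=B\,I(B<y)$. If $\rho\to1$, then $y^*\to x_B$.
   Context: Queue: single server working at unit speed; i.i.d. inter-arrival times distributed as $A$ and, independently, i.i.d. service times distributed as $B$. Standing assumptions: $\rho=\mathbb{E}\{B\}/\mathbb{E}\{A\}<1$; $\mathbb{P}\{B>A\}>0$; $B$ is light-tailed, i.e. $\mathbb{E}\{e^{sB}\}$ is finite for $s$ in a neighborhood of $0$; and $B$ has a density. The quantities $\gamma_w$, $\gamma_p^y$ and $y^*$ are regarded as functions of the load $\rho$. The decay rate of a random variable $U$ is the number $\gamma_u$ with $\log\mathbb{P}\{U>x\}=-\gamma_u x+o(x)$ as $x\to\infty$. With $\Phi_X(s)=\mathbb{E}\{e^{sX}\}$ and $\Phi_A^{-1}$ the inverse function of $\Phi_A$, the decay rates are $$\gamma_w=\sup\{s:\Phi_A(-s)\Phi_B(s)\le1\},\qquad \gamma_p^y=\sup_{s\ge0}\left\{s+\Phi_A^{-1}\!\left(\frac1{\Phi_{B^y}(s)}\right)\right\}.$$ *)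

(* Defs.v *)
From HB Require Import structures.
From mathcomp Require Import all_boot all_order all_algebra.
From mathcomp Require Import all_classical all_reals all_analysis.
Set Implicit Arguments.
Unset Strict Implicit.
Unset Printing Implicit Defensive.
Import Order.TTheory GRing.Theory Num.Theory.
Import numFieldNormedType.Exports.
Local Open Scope classical_set_scope.
Local Open Scope ring_scope.
Local Open Scope ereal_scope.

Definition independent_rv d (T : measurableType d) (R : realType)
    (P : probability T R) (X Y : T -> R) : Prop :=
  forall E F : set R, measurable E -> measurable F ->
    P (X @^-1` E `&` Y @^-1` F) = P (X @^-1` E) * P (Y @^-1` F).

Definition has_density d (T : measurableType d) (R : realType)
    (P : probability T R) (X : T -> R) : Prop :=
  exists f : R -> R,
    [/\ measurable_fun setT f, (forall x, (0 <= f x)%R) &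
        forall E, measurable E ->
          P (X @^-1` E) = \int[lebesgue_measure]_(x in E) (f x)%:E].

Definition light_tailed d (T : measurableType d) (R : realType)
    (P : probability T R) (X : T -> R) : Prop :=
  \forall s \near (0%R : R), 'M_P X s < +oo.

(* Extended division: the load is +oo if E[A] = 0 < E[B], and 0 if
   E[A] = +oo and E[B] is finite. *)
Definition load d (T : measurableType d) (R : realType)
    (P : probability T R) (A B : T -> R) : \bar R :=
  'E_P[B] / 'E_P[A].

Definition right_endpoint d (T : measurableType d) (R : realType)
    (P : probability T R) (B : T -> R) : \bar R :=
  ereal_sup [set x%:E | x in [set x : R | 0 < P [set w | (x < B w)%R]]].

Definition truncated (T : Type) (R : realType) (B : T -> R) (y : R) : T -> R :=
  fun w => if (B w < y)%R then B w else 0%R.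

(* The inverse of the moment generating function of A. If A >= 0 and A is not
   a.s. zero, there is at most one preimage of 0 <= v <= 1; the value is -oo
   outside the range, i.e. for v <= P(A = 0), so that such v do not contribute
   to the supremum in [gamma_p]. *)
Definition mgf_inv d (T : measurableType d) (R : realType)
    (P : probability T R) (A : T -> R) (v : \bar R) : \bar R :=
  ereal_sup [set u%:E | u in [set u : R | 'M_P A u = v]].

(* Decay rate of the steady-state workload at arrival epochs. *)
Definition gamma_w d (T : measurableType d) (R : realType)
    (P : probability T R) (A B : T -> R) : \bar R :=
  ereal_sup [set s%:E | s in
    [set s : R | 'M_P A (- s)%R * 'M_P B s <= 1]].

(* Decay rate of the busy period; gamma_p^y is
   [gamma_p P A (truncated B y)]. *)
Definition gamma_p d (T : measurableType d) (R : realType)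
    (P : probability T R) (A B : T -> R) : \bar R :=
  ereal_sup [set s%:E + mgf_inv P A ('M_P B s)^-1 | s in
    [set s : R | (0 <= s)%R]].

Definition y_star d (T : measurableType d) (R : realType)
    (P : probability T R) (A B : T -> R) : \bar R :=
  ereal_sup [set y%:E | y in
    [set y : R | gamma_w P A B <= gamma_p P A (truncated B y)]].

(* Main.v *)
(* Write a = E A and b = E B, so that a decreases to b when the load tends to 1.
   Lower bound: every g > 0 with Phi_A(-g) Phi_B(g) <= 1 is O(a - b), because
   Phi_A(-g) >= e^(-a g) by Jensen while Phi_B(g) e^(-a g) gains a term of order
   g^2, B not being constant. The laws of the A_i are arbitrary, so gamma_p^y
   need not stay away from 0; however Phi_A(-g) <= 1 / (1 + b g) forces the
   defect E[g A - 1 + e^(-g A)] to be o(g), and the defect at 2 g is at most 6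
   times the one at g. Hence Phi_A(-c g) <= 1 - a c g + o(g) for any fixed
   c = 2^n, and E B^y < b yields Phi_A(-c g) Phi_{B^y}((c + 1) g) <= 1 for c
   large, i.e. gamma_p^y >= (c + 1) g - c g = g.
   Upper bound: if y > x_B then B^y = B almost surely, and s + Phi_A^{-1}(1 /
   Phi_B(s)) stays away from gamma_w: for s small because Phi_A^{-1} <= 0 there,
   for s close to gamma_w because Phi_A^{-1} is negative, and for s > gamma_w
   because the sum is negative. *)
Require Import Defs.
From HB Require Import structures.
From mathcomp Require Import all_boot all_order all_algebra.
From mathcomp Require Import ring lra.
From mathcomp Require Import all_classical all_reals all_analysis.
From mathcomp Require Import measurable_realfun.
Import Order.TTheory GRing.Theory Num.Theory.
Import numFieldNormedType.Exports.
Set Implicit Arguments.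
Unset Strict Implicit.
Unset Printing Implicit Defensive.
Local Open Scope classical_set_scope.
Local Open Scope ring_scope.

(** * Elementary bounds on the exponential *)

Section exponential_bounds.
Context {R : realType}.
Implicit Types x : R.

Lemma expR_ge_tangent x y : expR y * (1 + (x - y)) <= expR x.
Proof.
have -> : expR x = expR y * expR (x - y) by rewrite -expRD addrC subrK.
by rewrite ler_pM2l ?expR_gt0// expR_ge1Dx.
Qed.

(** Square of [1 + x / 2 <= expR (x / 2)]. *)
Lemma expR_ge1Dx_sqr x : 0 <= x -> 1 + x + x ^+ 2 / 4 <= expR x.
Proof.
move=> x0; have -> : expR x = expR (x / 2) ^+ 2.
  by rewrite expr2 -expRD; congr expR; lra.
have := expR_ge1Dx (x / 2); move: (expR _) => r hr; nra.
Qed.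

(** From e^-x >= 1 - x, since (1 - x)(1 + x + 2x^2) = 1 + x^2 (1 - 2x), which is at least 1 exactly
    up to x = 1/2. *)
Lemma expR_le1Dx_sqr x : 0 <= x <= 2^-1 -> expR x <= 1 + x + 2 * x ^+ 2.
Proof.
move=> /andP[x0 x1].
have := expR_ge1Dx (- x); rewrite expRN => h.
have e0 := expR_gt0 x.
have : (1 - x) * expR x <= 1.
  by rewrite -ler_pdivlMr// mul1r.
move: (expR x) e0 => e e0 he; nra.
Qed.

Lemma expRN_le_quad x : 0 <= x -> expR (- x) <= 1 - x + x ^+ 2.
Proof.
move=> x0; rewrite expRN; apply: le_trans (_ : (1 + x)^-1 <= _).
  rewrite lef_pV2 ?posrE ?expR_gt0 ?expR_ge1Dx//; lra.
rewrite -[leLHS]mul1r ler_pdivrMr; last lra.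
have -> : (1 - x + x ^+ 2) * (1 + x) = 1 + x ^+ 3 by ring.
by rewrite lerDl exprn_ge0.
Qed.

(* The defect x - 1 + e^-x is quadratic near 0 and linear at infinity, hence
   doubling. With q = e^-x and r = e^(-x/2), the defect at 2x is twice the one
   at x plus (1 - q)^2, and the defect at x is at least (1 - r)^2. *)
Lemma expRN_defect_double x : 0 <= x ->
  x * 2 - 1 + expR (- (x * 2)) <= 6 * (x - 1 + expR (- x)).
Proof.
move=> x0; have := expR_ge1Dx (- (x / 2)).
have -> : expR (- x) = expR (- (x / 2)) ^+ 2.
  by rewrite expr2 -expRD; congr expR; lra.
have -> : expR (- (x * 2)) = expR (- (x / 2)) ^+ 4.
  by rewrite -expRM_natl; congr expR; lra.
have : expR (- (x / 2)) <= 1 by rewrite -[leRHS]expR0 ler_expR; lra.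
have := expR_gt0 (- (x / 2)).
move: (expR _) => r r0 r1 hr.
have : (1 - r ^+ 2) ^+ 2 <= 4 * (1 - r) ^+ 2.
  have -> : (1 - r ^+ 2) ^+ 2 = (1 - r) ^+ 2 * (1 + r) ^+ 2 by ring.
  rewrite [4 * _]mulrC ler_wpM2l ?sqr_ge0//; nra.
have : (1 - r) ^+ 2 = 1 - 2 * r + r ^+ 2 by ring.
have : (1 - r ^+ 2) ^+ 2 = 1 - 2 * r ^+ 2 + r ^+ 4 by ring.
move: (_ ^+ 2) => a; lra.
Qed.

End exponential_bounds.

(** * Real-valued expectations and moment generating functions *)

Section expectation_real.
Context d (T : measurableType d) (R : realType) (P : probability T R).
Implicit Types (f g X : T -> R).

Local Notation itg f := (P.-integrable setT (EFin \o f)).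

Lemma integrable_cstT (c : R) : itg (cst c).
Proof. exact: finite_measure_integrable_cst. Qed.

Lemma integrableDT f g : itg f -> itg g -> itg (fun w => f w + g w).
Proof. exact: integrableD. Qed.

Lemma integrableZT (c : R) f : itg f -> itg (fun w => c * f w).
Proof. exact: integrableZl. Qed.

Lemma integrable_affine (c0 c1 : R) f : itg f -> itg (fun w => c0 + c1 * f w).
Proof.
by move=> ?; apply: integrableDT; [exact: integrable_cstT|exact: integrableZT].
Qed.

Lemma Rintegral_affine (c0 c1 : R) f : itg f ->
  \int[P]_w (c0 + c1 * f w) = c0 + c1 * \int[P]_w f w.
Proof.
move=> fi; rewrite RintegralD//; [|exact: integrable_cstT|exact: integrableZT].
by rewrite RintegralZl// Rintegral_cst//= (@probability_setT _ _ _ P) mulr1.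
Qed.

Lemma measurable_itg f : itg f -> measurable_fun setT f.
Proof. by move=> /integrableP[/measurable_EFinP]. Qed.

Lemma ae_integrable_le f g : measurable_fun setT f -> itg g ->
  {ae P, forall w, `|f w| <= g w} -> itg f.
Proof.
move=> mf gi fg; apply/integrableP; split; first exact/measurable_EFinP.
have /integrableP[mg] := gi; apply: le_lt_trans; apply: ae_ge0_le_integral => //.
- by apply: measurableT_comp => //; exact/measurable_EFinP.
- exact: measurableT_comp.
- by apply: filterS fg => w h _ /=; rewrite lee_fin (le_trans h)// ler_norm.
Qed.

Lemma ae_integrable_bounded f (c : R) : measurable_fun setT f ->
  {ae P, forall w, `|f w| <= c} -> itg f.
Proof. by move=> mf; apply: ae_integrable_le => //; exact: integrable_cstT. Qed.

Lemma ae_eq_Rintegral f g : measurable_fun setT f -> measurable_fun setT g ->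
  {ae P, forall w, f w = g w} -> \int[P]_w f w = \int[P]_w g w.
Proof.
move=> mf mg fg; rewrite /Rintegral; congr fine; apply: ae_eq_integral => //.
- exact/measurable_EFinP.
- exact/measurable_EFinP.
- by apply: filterS fg => w ->.
Qed.

Lemma ae_le_Rintegral f g : itg f -> itg g ->
  {ae P, forall w, f w <= g w} -> \int[P]_w f w <= \int[P]_w g w.
Proof.
move=> fi gi fg; rewrite -subr_ge0 -RintegralB//.
have mB : measurable_fun setT (fun w => g w - f w).
  by apply: measurable_funB; exact: measurable_itg.
rewrite (@ae_eq_Rintegral _ (fun w => `|g w - f w|))//; last first.
- by apply: filterS fg => w fgw; rewrite ger0_norm// subr_ge0.
- exact: measurableT_comp.
by apply: Rintegral_ge0.
Qed.

Lemma EFin_Rintegral f : itg f -> (\int[P]_w f w)%:E = (\int[P]_w (f w)%:E)%E.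
Proof. by move=> fi; rewrite fineK// integrable_fin_num. Qed.

Lemma measurable_expRM X (u : R) : measurable_fun setT X ->
  measurable_fun setT (fun w => expR (X w * u)).
Proof. by move=> mX; apply: measurableT_comp => //; exact: measurable_funM. Qed.

Lemma mgf_integrable X (u : R) : itg (fun w => expR (X w * u)) ->
  'M_P X u = (\int[P]_w expR (X w * u))%:E.
Proof. by move=> eX; rewrite /mmt_gen_fun unlock EFin_Rintegral. Qed.

Lemma mgf_ltyP X (u : R) : measurable_fun setT X ->
  ('M_P X u < +oo)%E -> itg (fun w => expR (X w * u)).
Proof.
move=> mX; rewrite /mmt_gen_fun unlock => h; apply/integrableP; split.
  by apply/measurable_EFinP; exact: measurable_expRM.
apply: le_lt_trans h; apply: ge0_le_integral => //.
- by apply: measurableT_comp => //; apply/measurable_EFinP; exact: measurable_expRM.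
- by apply/measurable_EFinP; exact: measurable_expRM.
- by move=> w _ /=; rewrite lee_fin ger0_norm// expR_ge0.
Qed.

Lemma mgf_ge0 X (u : R) : (0 <= 'M_P X u)%E.
Proof. by apply: expectation_ge0 => w; exact: expR_ge0. Qed.

Lemma ae_eq_mgf X Y (u : R) : measurable_fun setT X -> measurable_fun setT Y ->
  {ae P, forall w, X w = Y w} -> 'M_P X u = 'M_P Y u.
Proof.
move=> mX mY XY; rewrite /mmt_gen_fun unlock; apply: ae_eq_integral => //.
- by apply/measurable_EFinP; exact: measurable_expRM.
- by apply/measurable_EFinP; exact: measurable_expRM.
- by apply: filterS XY => w h _ /=; rewrite h.
Qed.

(** Integrate [expR_ge1Dx]; an infinite transform satisfies the bound trivially. *)
Lemma mgf_ge1D X (u : R) : itg X -> ((1 + (\int[P]_w X w) * u)%:E <= 'M_P X u)%E.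
Proof.
move=> Xi; have [|] := ltP ('M_P X u) +oo%E; last first.
  by rewrite leye_eq => /eqP ->; rewrite leey.
move=> /(mgf_ltyP (measurable_itg Xi)) ei.
rewrite mgf_integrable// lee_fin mulrC -Rintegral_affine//.
apply: ae_le_Rintegral => //; first exact: integrable_affine.
by apply: nearW => w; rewrite [u * _]mulrC expR_ge1Dx.
Qed.

Lemma ae_Rintegral_ge0 (X : T -> R) : {ae P, forall w, 0 <= X w} ->
  itg X -> 0 <= \int[P]_w X w.
Proof.
move=> X0 Xi; rewrite -[leLHS](_ : \int[P]_w (cst 0 : T -> R) w = 0).
  by apply: ae_le_Rintegral => //; exact: integrable_cstT.
by rewrite Rintegral_cst// mul0r.
Qed.

Lemma Rintegral_indicZ (c : R) (E : set T) : measurable E ->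
  itg (fun w => c * \1_E w) /\ \int[P]_w (c * \1_E w) = c * fine (P E).
Proof.
move=> mE; have i1 : itg (\1_E : T -> R) by exact: integrable_indic.
split; first exact: integrableZT.
by rewrite RintegralZl// /Rintegral integral_indic// setIT.
Qed.

Lemma integrable_mgf_bounded (X : T -> R) (y s : R) : measurable_fun setT X ->
  {ae P, forall w, 0 <= X w <= y} -> 0 <= s -> itg (fun w => expR (X w * s)).
Proof.
move=> mX Xy s0; apply: (ae_integrable_bounded (c := expR (y * s))).
  exact: measurable_expRM.
apply: filterS Xy => w /andP[_ Xwy] /=.
by rewrite ger0_norm ?expR_ge0// ler_expR ler_wpM2r.
Qed.

Lemma integrable_bounded (X : T -> R) (y : R) : measurable_fun setT X ->
  {ae P, forall w, 0 <= X w <= y} -> itg X.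
Proof.
move=> mX Xy; apply: (ae_integrable_bounded (c := y) mX).
by apply: filterS Xy => w /andP[h1 h2]; rewrite ger0_norm.
Qed.

Lemma mgf_bounded_le (X : T -> R) (y s : R) : measurable_fun setT X ->
  {ae P, forall w, 0 <= X w <= y} -> 0 <= s -> y * s <= 2^-1 ->
  \int[P]_w expR (X w * s) <= 1 + (\int[P]_w X w) * s + 2 * (y * s) ^+ 2.
Proof.
move=> mX Xy s0 ys.
have -> : 1 + (\int[P]_w X w) * s + 2 * (y * s) ^+ 2 =
    (1 + 2 * (y * s) ^+ 2) + s * \int[P]_w X w by ring.
have Xi := integrable_bounded mX Xy.
rewrite -Rintegral_affine//; apply: ae_le_Rintegral.
- exact: integrable_mgf_bounded Xy s0.
- exact: integrable_affine.
apply: filterS Xy => w /andP[h1 h2].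
have h3 : 0 <= X w * s by rewrite mulr_ge0.
have h4 : X w * s <= y * s by rewrite ler_wpM2r.
have : (X w * s) ^+ 2 <= (y * s) ^+ 2.
  by rewrite lerXn2r ?nnegrE// (le_trans h3).
have /expR_le1Dx_sqr : 0 <= X w * s <= 2^-1 by rewrite h3 (le_trans h4).
by move: (expR _) => e; lra.
Qed.

End expectation_real.

(** * The Laplace transform of a nonnegative integrable variable *)

Section laplace_transform.
Context d (T : measurableType d) (R : realType) (P : probability T R).
Context (A : T -> R).
Context (A_ge0 : {ae P, forall w, 0 <= A w}).

Local Notation itg f := (P.-integrable setT (EFin \o f)).
Local Notation L u := (\int[P]_w expR (A w * u)).
Local Notation a := (\int[P]_w A w).

Lemma le_mgf (u v : R) : measurable_fun setT A ->
  u <= v -> ('M_P A u <= 'M_P A v)%E.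
Proof.
move=> mA uv; apply: expectation_le => //.
- exact: measurable_expRM.
- exact: measurable_expRM.
- by move=> w; exact: expR_ge0.
- by move=> w; exact: expR_ge0.
- by apply: filterS A_ge0 => w Aw /=; rewrite ler_expR ler_wpM2l.
Qed.

Context (Ai : itg A).

Lemma integrable_laplace (u : R) : u <= 0 -> itg (fun w => expR (A w * u)).
Proof.
move=> u0; apply: (ae_integrable_bounded (c := 1)).
  exact: (measurable_expRM _ (measurable_itg Ai)).
apply: filterS A_ge0 => w Aw /=.
by rewrite ger0_norm ?expR_ge0// -[leRHS]expR0 ler_expR mulr_ge0_le0.
Qed.

Lemma mgf_laplace (u : R) : u <= 0 -> 'M_P A u = (L u)%:E.
Proof. by move=> u0; rewrite mgf_integrable//; exact: integrable_laplace. Qed.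

(** Jensen's inequality, obtained by integrating the tangent of exp at the mean - a g. *)
Lemma laplace_ge_expR (g : R) : 0 <= g -> expR (- (a * g)) <= L (- g).
Proof.
move=> g0; set e := expR _.
have -> : e = e * (1 + a * g) + (e * - g) * a by ring.
rewrite -Rintegral_affine//; apply: ae_le_Rintegral.
- exact: integrable_affine.
- by apply: integrable_laplace; rewrite oppr_le0.
- apply: nearW => w; apply: le_trans (expR_ge_tangent _ (- (a * g))).
  by rewrite -/e le_eqVlt; apply/orP; left; apply/eqP; ring.
Qed.

(** On the negative axis the slope E[A e^(Au)] is at most E A. This yields the continuity behind
    [laplace_IVT]. *)
Lemma laplace_lipschitz (u v : R) : u <= v -> v <= 0 ->
  L u <= L v <= L u + a * (v - u).
Proof.
move=> uv v0; have u0 := le_trans uv v0.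
apply/andP; split.
  apply: ae_le_Rintegral; [exact: integrable_laplace..|].
  by apply: filterS A_ge0 => w Aw /=; rewrite ler_expR ler_wpM2l.
rewrite [a * _]mulrC -[X in X + _]addr0 -addrA.
have := Rintegral_affine 0 (v - u) Ai => <-.
rewrite -RintegralD//; [|exact: integrable_laplace|exact: integrable_affine].
apply: ae_le_Rintegral; first exact: integrable_laplace.
  apply: integrableDT; [exact: integrable_laplace|exact: integrable_affine].
apply: filterS A_ge0 => w Aw /=.
have := expR_ge_tangent (A w * u) (A w * v).
have : expR (A w * v) <= 1.
  by rewrite -[leRHS]expR0 ler_expR mulr_ge0_le0.
have := expR_gt0 (A w * v).
have : 0 <= A w * (v - u) by rewrite mulr_ge0// subr_ge0.
move: (expR (A w * v)) (expR _) => x y; nra.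
Qed.

(** Supplies the preimages over which [mgf_inv] takes its supremum. *)
Lemma laplace_IVT (u v : R) : u <= 0 -> L u <= v <= 1 ->
  exists2 x, u <= x <= 0 & L x = v.
Proof.
move=> u0 /andP[uv v1].
have a0 := ae_Rintegral_ge0 A_ge0 Ai.
(* Clamping at 0 gives a function continuous on the whole line, whereas the transform of A may be
   infinite to the right of 0. *)
pose f x := L (Num.min x 0).
have lip x y : x <= y -> `|f x - f y| <= a * (y - x).
  move=> xy.
  have /laplace_lipschitz : Num.min x 0 <= Num.min y 0 by rewrite le_min2.
  rewrite ge_min lexx orbT => /(_ isT) /andP[h1 h2].
  rewrite distrC ger0_norm ?subr_ge0// lerBlDl (le_trans h2)// lerD2l.
  rewrite ler_wpM2l// /Num.min.
  by case: ifPn => hy; case: ifPn => hx; lra.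
have cf : continuous f.
  move=> x; apply/cvgrPdist_le => e e0.
  near=> y.
  apply: (@le_trans _ _ (a * `|x - y|)).
    have [xy|/ltW yx] := leP x y.
      by rewrite (le_trans (lip _ _ xy))// distrC ger0_norm ?subr_ge0.
    by rewrite distrC (le_trans (lip _ _ yx))// ger0_norm ?subr_ge0.
  apply: (@le_trans _ _ ((a + 1) * `|x - y|)).
    by rewrite ler_wpM2r// lerDl.
  rewrite mulrC -ler_pdivlMr; last lra.
  near: y; apply: cvgr_dist_le; first exact: cvg_id.
  by rewrite divr_gt0//; lra.
have f0 : f 0 = 1.
  rewrite /f minxx; under eq_Rintegral do rewrite mulr0 expR0.
  by rewrite Rintegral_cst//= (@probability_setT _ _ _ P) mulr1.
have fu : f u = L u by rewrite /f min_l.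
have [||x] := @IVT R f u 0 v u0.
- exact: continuous_subspaceT.
- by rewrite f0 fu ge_min uv/= le_max v1 orbT.
rewrite in_itv/= => /andP[ux x0] fx.
by exists x; rewrite ?ux// -fx /f min_l.
Unshelve. all: end_near. Qed.

Let defect (g : R) := a * g - 1 + L (- g).

Lemma laplace_defect_double (g : R) : 0 <= g -> defect (g * 2) <= 6 * defect g.
Proof.
(* A multiple of the defect is the integral of a single integrand, so the doubling inequality can be
   integrated pointwise. *)
have intdef (c h : R) : 0 <= h ->
    itg (fun w => (- c + (c * h) * A w) + c * expR (A w * - h)) /\
    \int[P]_w ((- c + (c * h) * A w) + c * expR (A w * - h)) = c * defect h.
  move=> h0.
  have i1 : itg (fun w => - c + (c * h) * A w) by exact: integrable_affine.
  have i2 : itg (fun w => expR (A w * - h)).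
    by apply: integrable_laplace; rewrite oppr_le0.
  split; first by apply: integrableDT => //; exact: integrableZT.
  rewrite RintegralD//; last exact: integrableZT.
  by rewrite Rintegral_affine// RintegralZl// /defect; ring.
move=> g0; have [i1 e1] := intdef 6 g g0.
have [|i2 e2] := intdef 1 (g * 2); first by rewrite mulr_ge0.
rewrite -e1 -[leLHS]mul1r -e2; apply: ae_le_Rintegral => //.
apply: filterS A_ge0 => w Aw.
have /expRN_defect_double : 0 <= A w * g by rewrite mulr_ge0.
by rewrite !mulrN [A w * (g * 2)]mulrA; move: (expR _) (expR _) => x y; lra.
Qed.

Lemma laplace_defect_pow n (g : R) : 0 <= g ->
  L (- (g * 2 ^+ n)) <= 1 - a * (g * 2 ^+ n) + 6 ^+ n * (a * g - 1 + L (- g)).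
Proof.
move=> g0; rewrite -lerBlDl opprB.
have -> : L (- (g * 2 ^+ n)) + (a * (g * 2 ^+ n) - 1) = defect (g * 2 ^+ n).
  by rewrite /defect addrC.
elim: n => [|n ih]; first by rewrite !expr0 mulr1 mul1r.
rewrite !exprSr [6 ^+ n * _]mulrC !mulrA.
apply: le_trans (laplace_defect_double _) _.
  by rewrite mulr_ge0// exprn_ge0.
by rewrite -mulrA ler_wpM2l.
Qed.

(** The slope of g -> L (- g) at 0 is - a. As A may have infinite variance, A is first capped at a
    level n that keeps the mean above b; the capped variable has a quadratic error term. *)
Lemma laplace_le_affine (b : R) : b < a ->
  exists2 e, 0 < e & forall g, 0 <= g <= e -> L (- g) <= 1 - b * g.
Proof.
move=> ba.
have mA := measurable_itg Ai.
pose f (n : nat) w := Num.min (A w) n%:R.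
have mf n : measurable_fun setT (f n) by exact: measurable_minr.
have f_ge0 n : {ae P, forall w, 0 <= f n w <= A w}.
  by apply: filterS A_ge0 => w Aw; rewrite /f le_min Aw ler0n ge_min lexx.
have [n hn] : exists n, b < \int[P]_w f n w.
  have [|||||_ _] := @dominated_convergence _ _ _ P setT measurableT
    (fun n => EFin \o f n) (EFin \o A) (EFin \o A).
  - by move=> n; exact/measurable_EFinP.
  - exact/measurable_EFinP.
  - apply: nearW => w _; apply: cvg_near_cst.
    near=> n; rewrite /= /f min_l//; near: n.
    exact: nbhs_infty_ger.
  - exact: Ai.
  - apply: filterS A_ge0 => w Aw n _ /=.
    by rewrite lee_fin ger0_norm /f ?le_min ?Aw ?ler0n// ge_min lexx.
  rewrite -(EFin_Rintegral Ai) => /fine_cvgP[_] /cvgr_gt /(_ _ ba) [n _ /(_ n)].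
  by move=> /(_ (leqnn n)) h; exists n.
have fi : itg (f n).
  apply: ae_integrable_le Ai _ => //.
  by apply: filterS (f_ge0 n) => w /andP[h1 h2]; rewrite ger0_norm.
pose m := \int[P]_w f n w.
(* For g below this bound the error g^2 (n + 1)^2 is at most (m - b) g. Taking n + 1 avoids a zero
   denominator. *)
exists ((m - b) / n.+1%:R ^+ 2); first by rewrite divr_gt0// subr_gt0.
move=> g /andP[g0]; rewrite ler_pdivlMr// => ge.
apply: (@le_trans _ _ ((1 + g ^+ 2 * n.+1%:R ^+ 2) + (- g) * m)); last by nra.
rewrite -Rintegral_affine//; apply: ae_le_Rintegral.
- by apply: integrable_laplace; rewrite oppr_le0.
- exact: integrable_affine.
- apply: filterS (f_ge0 n) => w /andP[h1 h2].
  have h3 : f n w <= n.+1%:R.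
    by rewrite /f ge_min; apply/orP; right; rewrite ler_nat.
  have := @expRN_le_quad _ (f n w * g) (mulr_ge0 h1 g0).
  have : expR (A w * - g) <= expR (- (f n w * g)).
    by rewrite mulrN ler_expR lerN2 ler_wpM2r.
  have : (f n w * g) ^+ 2 <= g ^+ 2 * n.+1%:R ^+ 2.
    by rewrite exprMn mulrC ler_wpM2l ?sqr_ge0// lerXn2r ?nnegrE.
  by move: (expR _) (expR _) => x y; lra.
Unshelve. all: end_near. Qed.

End laplace_transform.

(** * Truncation and spread of the service time *)

Section service_time.
Context d (T : measurableType d) (R : realType) (P : probability T R).
Context (B : T -> R).

Local Notation itg f := (P.-integrable setT (EFin \o f)).
Local Notation b := (\int[P]_w B w).

Context (B_ge0 : {ae P, forall w, 0 <= B w}).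
Context (mB : measurable_fun setT B).

(** One finite exponential moment at a positive point e / 2 dominates B, because (e / 2) x <= e^((e
    / 2) x). *)
Lemma light_tailed_integrable : light_tailed P B -> itg B.
Proof.
move=> /nbhs_ballP[e/= e0 /(_ (e / 2))] h.
have {h} : ('M_P B (e / 2) < +oo)%E.
  by apply: h; rewrite /ball/= sub0r normrN ger0_norm; lra.
move=> /(mgf_ltyP mB) => /(integrableZT (e / 2)^-1) i.
apply: ae_integrable_le i _ => //.
apply: filterS B_ge0 => w Bw; rewrite ger0_norm// mulrC ler_pdivlMr; last lra.
by apply: le_trans (expR_ge1Dx _); lra.
Qed.

Lemma measurable_truncated (y : R) : measurable_fun setT (truncated B y).
Proof. by apply: measurable_fun_ifT => //; exact: measurable_fun_ltr. Qed.

Lemma truncated_bounded (y : R) : 0 <= y ->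
  {ae P, forall w, 0 <= truncated B y w <= y}.
Proof.
move=> y0; apply: filterS B_ge0 => w Bw; rewrite /truncated.
by case: ifPn => [/ltW ->|_]; rewrite ?Bw ?lexx.
Qed.

Lemma measurable_gt (x : R) : measurable [set w | x < B w].
Proof.
rewrite [X in measurable X](_ : _ = B @^-1` `]x, +oo[).
  by rewrite -[_ @^-1` _]setTI; exact: mB.
by apply/seteqP; split => w /=; rewrite in_itv/= andbT.
Qed.

Context (Bi : itg B).

(** As y < x, the truncation vanishes on {B > x}, so B dominates the truncation plus x times the
    indicator of that event, which has positive mean. *)
Lemma Rintegral_truncated_lt (x y : R) : 0 <= y < x ->
  (0 < P [set w | (x < B w)%R])%E -> \int[P]_w truncated B y w < b.
Proof.
move=> /andP[y0 yx] Px.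
have [i1 e1] := Rintegral_indicZ P x (measurable_gt x).
have p0 : 0 < x * fine (P [set w | x < B w]).
  rewrite mulr_gt0//; first exact: le_lt_trans yx.
  by rewrite fine_gt0// Px/= (le_lt_trans (probability_le1 _ _)) ?ltry//;
    exact: measurable_gt.
apply: lt_le_trans (_ : \int[P]_w (truncated B y w + x * \1_[set w | x < B w] w) <= _).
  have ti := integrable_bounded (measurable_truncated y) (truncated_bounded y0).
  by rewrite RintegralD// e1 ltrDl.
apply: ae_le_Rintegral => //.
  apply: integrableDT i1.
  exact: integrable_bounded (measurable_truncated y) (truncated_bounded y0).
apply: filterS B_ge0 => w Bw; rewrite indicE /truncated.
case: ifPn => [Bwy|_].
  by rewrite memNset ?mulr0 ?addr0//=; apply/negP; rewrite -leNgt; lra.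
have [h|h] := boolP (x < B w).
  by rewrite mem_set//= mulr1 add0r ltW.
by rewrite memNset ?mulr0 ?addr0//=; exact/negP.
Qed.

(* Second order in g because a non-constant B spreads above a. *)
Lemma mgf_ge_spread (a h t g : R) : 0 <= h -> a + h <= t -> 0 <= g ->
  itg (fun w => expR (B w * g)) ->
  expR (a * g) * (1 + (b - a) * g +
     h ^+ 2 / 4 * fine (P [set w | t < B w]) * g ^+ 2) <=
  \int[P]_w expR (B w * g).
Proof.
move=> h0 aht g0 ei.
set e := expR _; set S := [set w | _].
have mS : measurable S by exact: measurable_gt.
have [i1 e1] := Rintegral_indicZ P (e * (h ^+ 2 / 4 * g ^+ 2)) mS.
have -> : e * (1 + (b - a) * g + h ^+ 2 / 4 * fine (P S) * g ^+ 2) =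
    ((e * (1 - a * g)) + (e * g) * b) + e * (h ^+ 2 / 4 * g ^+ 2) * fine (P S).
  by ring.
rewrite -e1 -Rintegral_affine// -RintegralD//; last exact: integrable_affine.
apply: ae_le_Rintegral => //.
  by apply: integrableDT => //; exact: integrable_affine.
apply: nearW => w.
have -> : expR (B w * g) = e * expR ((B w - a) * g).
  by rewrite /e -expRD; congr expR; ring.
rewrite -mulrA -mulrA -!mulrDr ler_wpM2l ?expR_ge0// indicE.
have [/set_mem /= tB|_] := boolP (w \in S); last first.
  by rewrite mulr0 addr0; apply: le_trans (expR_ge1Dx _); lra.
have hB : h <= B w - a by have : t < B w := tB; lra.
have Ba0 : 0 <= B w - a by lra.
have /expR_ge1Dx_sqr : 0 <= (B w - a) * g by rewrite mulr_ge0.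
have : (h * g) ^+ 2 <= ((B w - a) * g) ^+ 2.
  by rewrite lerXn2r ?nnegrE ?mulr_ge0// ler_wpM2r.
rewrite !exprMn.
by move: (expR _) => z; lra.
Qed.

Lemma density_atomless (c : R) : has_density P B -> P [set w | B w = c] = 0%E.
Proof.
by move=> [f [_ _ /(_ [set c] (measurable_set1 _))]]; rewrite integral_set1.
Qed.

(** Otherwise B <= b almost surely; then b - B is nonnegative with mean 0, so B = b almost surely,
    which is an atom. *)
Lemma atomless_above_mean : (forall c, P [set w | B w = c] = 0%E) ->
  exists2 t, b < t & (0 < P [set w | (t < B w)%R])%E.
Proof.
move=> Bc; apply: contrapT => noT.
have null t : b < t -> {ae P, forall w, B w <= t}.
  move=> bt; exists [set w | t < B w]; split.
  - exact: measurable_gt.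
  - apply/eqP; rewrite eq_le measure_ge0 andbT leNgt; apply/negP => Pt.
    by apply: noT; exists t.
  - by move=> w /= /negP; rewrite -ltNge.
have le_b : {ae P, forall w, B w <= b}.
  have : {ae P, forall w, forall n : nat, B w <= b + n.+1%:R^-1}.
    by apply: ae_foralln => n; apply: null; rewrite ltrDl.
  apply: filterS => w h; apply/ler_addgt0Pr => e e0.
  have [n hn] := ltr_add_invr (ltac:(by []) : (0 : R) < e).
  apply: le_trans (h n) _; rewrite lerD2l; move: hn; rewrite add0r => /ltW//.
have : ae_eq P setT (fun w => (b - B w)%:E) (cst 0%E).
  have Di : itg (fun w => b + (- 1) * B w) by exact: integrable_affine.
  apply/(ae_eq_integral_abs P measurableT).
    by apply/measurable_EFinP; exact: measurable_funB.
  rewrite (@ae_eq_integral _ _ _ P setT (EFin \o (fun w => b + (- 1) * B w)))//.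
  - rewrite -EFin_Rintegral// Rintegral_affine//; congr EFin; ring.
  - by apply: measurableT_comp => //; apply/measurable_EFinP; exact: measurable_funB.
  - by apply/measurable_EFinP; exact: measurable_itg Di.
  - apply: filterS le_b => w h _ /=; rewrite ger0_norm ?subr_ge0//.
    by rewrite mulN1r.
move=> beq.
have PT : (0 < P setT)%E by rewrite probability_setT.
have PF := ae_properfilter_algebraOfSetsType PT.
have nb : {ae P, forall w, B w <> b}.
  exists [set w | B w = b]; split => //.
    rewrite [X in measurable X](_ : _ = B @^-1` [set b]).
      by rewrite -[_ @^-1` _]setTI; exact: mB.
    by apply/seteqP; split.
  by move=> w /= /contrapT.
suff /filter_ex[] : {ae P, forall w : T, False} by [].
apply: filterS2 beq nb => w /(_ I) /= [] /eqP.
by rewrite subr_eq0 eq_sym => /eqP.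
Qed.

End service_time.

(** * Comparison of the two decay rates *)

Section decay_rates.
Context d (T : measurableType d) (R : realType) (P : probability T R).
Context (B : T -> R).
Context (B_ge0 : {ae P, forall w, 0 <= B w}).
Context (Bi : P.-integrable setT (EFin \o B)).

Local Notation itg f := (P.-integrable setT (EFin \o f)).
Local Notation b := (\int[P]_w B w).

Let mB : measurable_fun setT B := measurable_itg Bi.
Let b_ge0 : 0 <= b := ae_Rintegral_ge0 B_ge0 Bi.

(** The factor Phi_A(-g) is strictly positive, so an infinite Phi_B(g) would make the product
    infinite. The condition thus becomes an inequality between reals. *)
Lemma mgf_product_le1 (A : T -> R) (g : R) :
  {ae P, forall w, 0 <= A w} -> itg A -> 0 <= g ->
  ('M_P A (- g)%R * 'M_P B g <= 1)%E ->
  itg (fun w => expR (B w * g)) /\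
  (\int[P]_w expR (A w * - g)) * (\int[P]_w expR (B w * g)) <= 1.
Proof.
move=> A0 Ai g0; rewrite (mgf_laplace A0 Ai) ?oppr_le0//.
have Lgt0 : 0 < \int[P]_w expR (A w * - g).
  by apply: lt_le_trans (laplace_ge_expR A0 Ai g0); exact: expR_gt0.
have [/(mgf_ltyP mB) ei|] := ltP ('M_P B g) +oo%E; last first.
  by rewrite leye_eq => /eqP ->; rewrite gt0_muley.
by rewrite mgf_integrable// lee_fin.
Qed.

(** Multiplying [laplace_ge_expR] by [mgf_ge_spread] cancels e^(ag) and leaves 1 + (b - a) g + k g^2
    <= 1; divide by g. This is the O(a - b) bound on g. *)
Lemma gamma_w_elt_le (A : T -> R) (h t g : R) :
  {ae P, forall w, 0 <= A w} -> itg A -> 0 < g ->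
  0 <= h -> \int[P]_w A w + h <= t ->
  ('M_P A (- g)%R * 'M_P B g <= 1)%E ->
  h ^+ 2 / 4 * fine (P [set w | t < B w]) * g <= \int[P]_w A w - b.
Proof.
move=> A0 Ai gp h0 aht; have g0 := ltW gp.
move=> /(mgf_product_le1 A0 Ai g0)[ei MAB].
have hB := mgf_ge_spread mB Bi h0 aht g0 ei.
have hA := laplace_ge_expR A0 Ai g0.
move: hA hB MAB; rewrite expRN.
set e := expR _; set k := _ * fine _; set a := \int[P]_w A w.
set LA := Rintegral _ _ _; set MB := \int[P]_w expR (B w * g) => hA hB MAB.
have e0 : 0 < e by exact: expR_gt0.
have LA0 : 0 < LA by apply: lt_le_trans hA; rewrite invr_gt0.
(* Arguing by contradiction makes the bracket positive, as multiplying the two lower bounds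
   requires. *)
have : 1 + (b - a) * g + k * g ^+ 2 <= 1.
  rewrite leNgt; apply/negP => h1.
  have : e^-1 * (e * (1 + (b - a) * g + k * g ^+ 2)) <= 1.
    apply: le_trans MAB; apply: ler_pM => //.
    - by rewrite invr_ge0 ltW.
    - by rewrite mulr_ge0 ?ltW// (lt_trans _ h1).
  by rewrite mulKf ?gt_eqF// leNgt h1.
by move=> H; rewrite -(ler_pM2r gp); lra.
Qed.

(* The tilt s + u is realised with s = (2^n + 1) g and u >= - 2^n g. *)
Lemma gamma_p_ge (A X : T -> R) (y g : R) n :
  {ae P, forall w, 0 <= A w} -> itg A ->
  measurable_fun setT X -> {ae P, forall w, 0 <= X w <= y} -> 0 <= g ->
  b <= \int[P]_w A w ->
  ('M_P A (- g)%R * 'M_P B g <= 1)%E ->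
  y * ((2 ^+ n + 1) * g) <= 2^-1 ->
  (\int[P]_w X w) * (2 ^+ n + 1) + 2 * y ^+ 2 * (2 ^+ n + 1) ^+ 2 * g +
    6 ^+ n * (\int[P]_w A w - b + b ^+ 2 * g) <= \int[P]_w A w * 2 ^+ n ->
  (g%:E <= gamma_p P A X)%E.
Proof.
move=> A0 Ai mX X0y g0 ba /(mgf_product_le1 A0 Ai g0)[ei MAB] ys hp.
have X0 : {ae P, forall w, 0 <= X w}.
  by apply: filterS X0y => w /andP[].
have Xi := integrable_bounded mX X0y.
have bX0 := ae_Rintegral_ge0 X0 Xi.
have c0 : 0 <= 2 ^+ n :> R by rewrite exprn_ge0.
pose s := (2 ^+ n + 1) * g.
have s0 : 0 <= s by rewrite mulr_ge0// addr_ge0.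
have sXi := integrable_mgf_bounded mX X0y s0.
have M1 := mgf_bounded_le mX X0y s0 ys.
have M0 : 1 <= \int[P]_w expR (X w * s).
  have := mgf_ge1D s Xi; rewrite mgf_integrable// lee_fin; apply: le_trans.
  by rewrite lerDl mulr_ge0.
have L1 := laplace_defect_pow A0 Ai n g0.
(* Phi_A(-g) <= 1 / Phi_B(g) <= 1 / (1 + b g), expanded to second order. *)
have L2 : \int[P]_w expR (A w * - g) <= 1 - b * g + b ^+ 2 * g ^+ 2.
  have : 1 + b * g <= \int[P]_w expR (B w * g).
    by have := mgf_ge1D g Bi; rewrite mgf_integrable// lee_fin.
  have : 0 < \int[P]_w expR (A w * - g).
    by apply: lt_le_trans (laplace_ge_expR A0 Ai g0); exact: expR_gt0.
  move: MAB; set x := Rintegral _ _ _; set z := Rintegral _ _ _.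
  move=> MAB x0 hz.
  have hx : x * (1 + b * g) <= 1 by apply: le_trans MAB; rewrite ler_pM2l.
  have bg : 0 <= b * g by rewrite mulr_ge0.
  have : (1 - b * g + b ^+ 2 * g ^+ 2) * (1 + b * g) = 1 + (b * g) ^+ 3 by ring.
  have := exprn_ge0 3 bg.
  have b1 : 0 < 1 + b * g by lra.
  by move=> h3 h4; rewrite -(ler_pM2r b1); lra.
move: hp L1 L2 M0 M1 ys.
have : 0 <= 6 ^+ n :> R by rewrite exprn_ge0.
rewrite -/s.
have gc0 : - (g * 2 ^+ n) <= 0 by rewrite oppr_le0 mulr_ge0.
have := laplace_IVT A0 Ai gc0.
set a := \int[P]_w A w; set bX := \int[P]_w X w.
set LA := \int[P]_w expR (A w * - g).
set LC := \int[P]_w expR (A w * - (g * 2 ^+ n)).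
set MX := \int[P]_w expR (X w * s).
move=> IVT d0 hp L1 L2 M0 M1 ys.
have [|u /andP[u1 u2] Lu] := IVT (MX^-1).
  apply/andP; split; last by rewrite invf_le1// (lt_le_trans _ M0).
  (* By [L2] the defect at g is at most g (a - b + b^2 g), and [hp] absorbs 6^n times this. With q
     the subtracted term, LC <= 1 - q and MX <= 1 + q, so LC MX <= 1. *)
  have h1 : LC <= 1 - g * (bX * (2 ^+ n + 1) + 2 * y ^+ 2 * (2 ^+ n + 1) ^+ 2 * g).
    apply: le_trans L1 _.
    have : 6 ^+ n * (a * g - 1 + LA) <= 6 ^+ n * (g * (a - b + b ^+ 2 * g)).
      by rewrite ler_wpM2l//; lra.
    have := ler_wpM2l g0 hp.
    by lra.
  set q := g * _ in h1.
  have M2 : MX <= 1 + q by move: M1; rewrite /q /s; lra.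
  have MX0 : 0 < MX by apply: lt_le_trans M0.
  rewrite -[MX^-1]mul1r ler_pdivlMr//.
  have q0 : 0 <= q by lra.
  apply: le_trans (_ : (1 - q) * MX <= _).
    by rewrite ler_wpM2r// ltW.
  (* For q > 1 the factor 1 - q is negative and the product is trivially below 1. *)
  have [q1|q1] := leP q 1; first by nra.
  by nra.
apply: le_trans (_ : s%:E + u%:E <= _)%E.
  by rewrite -EFinD lee_fin /s; lra.
apply: le_trans (_ : s%:E + mgf_inv P A ('M_P X s)^-1 <= _)%E.
  rewrite leeD2l//; apply: ereal_sup_ubound; exists u => //=.
  rewrite mgf_laplace// Lu mgf_integrable// inver gt_eqF//.
  by rewrite (lt_le_trans _ M0).
by apply: ereal_sup_ubound; exists s.
Qed.

(** Take s = 0 and u = 0, both transforms being 1 there. This settles the elements g <= 0 in the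
    supremum defining [gamma_w]. *)
Lemma gamma_p_ge0 (A X : T -> R) : (0 <= gamma_p P A X)%E.
Proof.
have M0 (Y : T -> R) : 'M_P Y 0 = 1%E.
  rewrite /mmt_gen_fun -(expectation_cst P 1); congr ('E_P[_])%E.
  by apply/funext => w /=; rewrite mulr0 expR0.
apply: le_trans (_ : 0%:E + mgf_inv P A ('M_P X 0)^-1 <= _)%E.
  rewrite add0e; apply: ereal_sup_ubound; exists 0 => //=.
  by rewrite !M0 inve1.
by apply: ereal_sup_ubound; exists 0 => /=.
Qed.

(** The lower bound of [y_star]: e depends on B and X only, hence is uniform over the laws of A. *)
Lemma gamma_w_le_gamma_p (X : T -> R) (y t : R) :
  measurable_fun setT X -> 0 <= y -> {ae P, forall w, 0 <= X w <= y} ->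
  \int[P]_w X w < b -> b < t -> (0 < P [set w | (t < B w)%R])%E ->
  exists2 e, 0 < e & forall A : T -> R,
    {ae P, forall w, 0 <= A w} -> itg A -> b < \int[P]_w A w < b + e ->
    (gamma_w P A B <= gamma_p P A X)%E.
Proof.
move=> mX y0 X0y bXb bt Pt; set bX := \int[P]_w X w in bXb *.
pose h := (t - b) / 2.
have h0 : 0 < h by rewrite divr_gt0// subr_gt0.
pose k := h ^+ 2 / 4 * fine (P [set w | t < B w]).
have k0 : 0 < k.
  rewrite mulr_gt0 ?divr_gt0 ?exprn_gt0// fine_gt0// Pt/=.
  by rewrite (le_lt_trans (probability_le1 _ _)) ?ltry//; exact: measurable_gt.
(* This makes bX (2^n + 1) + 1 <= b 2^n; the spare 1 pays for all error terms. *)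
have [n hn] : exists n, bX + 1 <= 2 ^+ n * (b - bX).
  have d0 : 0 < b - bX by rewrite subr_gt0.
  exists (Num.truncn ((bX + 1) / (b - bX))).+1.
  rewrite -ler_pdivrMr// (le_trans (ltW (truncnS_gt _)))//.
  by rewrite -natrX ler_nat ltnW// ltn_expl.
pose c : R := 2 ^+ n + 1.
have c1 : 1 <= c by rewrite lerDr exprn_ge0.
pose m : R := 6 ^+ n.
have m0 : 0 <= m by rewrite exprn_ge0.
pose K := 2 * y ^+ 2 * c ^+ 2 + m * b ^+ 2.
have c0 : 0 <= c by apply: le_trans c1.
have K0 : 0 <= K by rewrite addr_ge0 // !mulr_ge0.
(* Given k g <= a - b, the bound a - b < e1 yields K g + m (a - b) <= 1 and a - b < e2 yields y c g
   <= 1/2; a - b < h gives a + h <= t. *)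
pose e1 := k / (K + m * k + 1); pose e2 := k / (2 * (y * c + 1)).
have mk0 : 0 <= m * k by rewrite mulr_ge0// ltW.
have yc0 : 0 <= y * c by rewrite mulr_ge0// (le_trans ler01).
exists (Num.min h (Num.min e1 e2)).
  by rewrite !lt_min h0 !divr_gt0//; lra.
move=> A A0 Ai; set a := \int[P]_w A w => /andP[ba].
rewrite -ltrBlDl !lt_min => /and3P[ah ae1 ae2].
apply: ge_ereal_sup => _ [g /= gP <-].
have [g0|g0] := leP g 0.
  by apply: le_trans (gamma_p_ge0 A X); rewrite lee_fin.
have kg : k * g <= a - b.
  by apply: (gamma_w_elt_le A0 Ai g0 (ltW h0)) gP; rewrite -/a /h; rewrite /h in ah; lra.
move: ae1 ae2; rewrite !ltr_pdivlMr; [|lra..] => ae1 ae2.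
have ab : 0 < a - b by rewrite subr_gt0.
apply: (gamma_p_ge A0 Ai mX X0y (ltW g0) (ltW ba) gP (n := n)).
  rewrite -/c -(ler_pM2r k0).
  have := ler_wpM2l yc0 kg; lra.
rewrite -/bX -/a -/c -/m.
have h1 : K * g + m * (a - b) <= 1.
  rewrite -(ler_pM2r k0).
  have := ler_wpM2l K0 kg; lra.
have h2 : b * 2 ^+ n <= a * 2 ^+ n by rewrite ler_wpM2r ?exprn_ge0// ltW.
move: h1 h2 hn; rewrite /K /c; lra.
Qed.

(** The upper bound of [y_star]: the inequality must be strict to exclude y from the set. The last
    hypothesis keeps [gamma_w] finite. *)
Lemma gamma_p_lt_gamma_w (A : T -> R) (y k : R) :
  {ae P, forall w, 0 <= A w} -> itg A -> 0 < b -> b < \int[P]_w A w ->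
  0 <= y -> {ae P, forall w, 0 <= B w <= y} -> 0 < k ->
  (forall g, 0 < g -> ('M_P A (- g)%R * 'M_P B g <= 1)%E ->
     k * g <= \int[P]_w A w - b) ->
  (gamma_p P A B < gamma_w P A B)%E.
Proof.
move=> A0 Ai; set a := \int[P]_w A w => b0 ba y0 B0y k0 kP.
have MB s : 0 <= s -> 'M_P B s = (\int[P]_w expR (B w * s))%:E.
  by move=> s0; rewrite mgf_integrable//; exact: integrable_mgf_bounded B0y s0.
have ab0 : 0 < a - b by rewrite subr_gt0.
have a0 : 0 < a by lra.
have [g0 g0_gt0 g0P] : exists2 g, 0 < g & ('M_P A (- g)%R * 'M_P B g <= 1)%E.
  have [|e e0 he] := @laplace_le_affine _ _ _ _ _ A0 Ai ((a + b) / 2).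
    by rewrite -/a; lra.
  have y1 : 0 < y ^+ 2 + 1 by rewrite ltr_wpDl ?sqr_ge0.
  (* The three bounds give Phi_A(-g) <= 1 - (a + b) g / 2, then 2 y^2 g <= (a - b) / 2, and y g <=
     1/2. So Phi_B(g) <= 1 + (a + b) g / 2 and the product is at most 1. *)
  pose g := Num.min e (Num.min ((a - b) / (4 * (y ^+ 2 + 1))) (2 * (y + 1))^-1).
  have g0 : 0 < g by rewrite !lt_min e0 divr_gt0 ?invr_gt0//; lra.
  exists g => //.
  have : g <= g by [].
  rewrite {2}/g !le_min => /and3P[ge].
  rewrite ler_pdivlMr; last lra.
  rewrite -[_^-1]mul1r ler_pdivlMr; last lra.
  move=> g1 g2.
  have g0' := ltW g0.
  rewrite MB// (mgf_laplace A0 Ai) ?oppr_le0// -EFinM lee_fin.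
  have gle : 0 <= g <= e by rewrite ge g0'.
  have h1 := he _ gle.
  have h2 : \int[P]_w expR (B w * g) <= 1 + b * g + 2 * (y * g) ^+ 2.
    by have := mgf_bounded_le mB B0y g0'; rewrite -/b [b * g]mulrC; apply; lra.
  have L0 : 0 <= \int[P]_w expR (A w * - g).
    by apply: le_trans (laplace_ge_expR A0 Ai (ltW g0)); exact: expR_ge0.
  have M0 : 0 <= \int[P]_w expR (B w * g).
    by have := mgf_ge0 P B g; rewrite MB.
  apply: (@le_trans _ _ ((1 - (a + b) / 2 * g) * (1 + b * g + 2 * (y * g) ^+ 2))).
    exact: ler_pM.
  have h3 : b * g + 2 * (y * g) ^+ 2 <= (a + b) / 2 * g.
    have -> : b * g + 2 * (y * g) ^+ 2 = (b + 2 * y ^+ 2 * g) * g by ring.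
    by rewrite ler_pM2r//; lra.
  have h4 : 0 <= b * g + 2 * (y * g) ^+ 2.
    by apply: addr_ge0; [rewrite mulr_ge0// ltW|rewrite mulr_ge0// sqr_ge0].
  move: h3 h4; set p := (a + b) / 2 * g; rewrite -addrA; set q := b * g + _.
  by move=> h3 h4; nra.
have Gge : (g0%:E <= gamma_w P A B)%E by apply: ereal_sup_ubound; exists g0.
have Gle : (gamma_w P A B <= ((a - b) / k)%:E)%E.
  apply: ge_ereal_sup => _ [g /= gP <-]; rewrite lee_fin ler_pdivlMr// mulrC.
  have [g_le0|g_gt0] := leP g 0; last exact: kP.
  by apply: (@le_trans _ _ 0); [rewrite mulr_ge0_le0// ltW|exact: ltW].
have : gamma_w P A B \is a fin_num.
  by rewrite fin_numElt (lt_le_trans (ltNyr _) Gge) (le_lt_trans Gle (ltry _)).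
move=> /fineK; move: (fine _) => G GE; rewrite -GE.
have G0 : 0 < G.
  by rewrite -lte_fin GE (lt_le_trans _ Gge).
have GP s : G < s -> (1 < 'M_P A (- s)%R * 'M_P B s)%E.
  move=> Gs; rewrite ltNge; apply/negP => sP.
  have : (s%:E <= gamma_w P A B)%E by apply: ereal_sup_ubound; exists s.
  by rewrite -GE lee_fin leNgt Gs.
have bG0 : 0 < b * (G / 2) by rewrite mulr_gt0// divr_gt0.
(* For s >= G / 2 a preimage u satisfies 1 + a u <= 1 / Phi_B(s) <= 1 / (1 + b G / 2), that is u <=
   - r. *)
pose r := (1 - (1 + b * (G / 2))^-1) / a.
have r0 : 0 < r.
  by rewrite divr_gt0// subr_gt0 invf_lt1 ?ltrDl//; lra.
(* The entries bound s + u for s <= G / 2, for G / 2 < s <= G, and for s > G; all are below G. *)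
pose m := Num.max (G / 2) (Num.max (G - r) 0).
suff : (gamma_p P A B <= m%:E)%E.
  move=> /le_lt_trans; apply; rewrite lte_fin !gt_max G0.
  by apply/and3P; split => //; lra.
apply: ge_ereal_sup => _ [s /= s0 <-].
rewrite -leeBrDl//; apply: ge_ereal_sup => _ [u /= uP <-].
rewrite -EFinD lee_fin lerBrDl.
have M1 : 1 + b * s <= \int[P]_w expR (B w * s).
  by have := mgf_ge1D s Bi; rewrite MB.
have bs0 : 0 <= b * s by rewrite mulr_ge0// ltW.
move: uP; rewrite MB// inver; set M := \int[P]_w expR (B w * s) in M1 *.
have M0 : 0 < M by lra.
rewrite gt_eqF// => uP.
have u1 : 1 + a * u <= M^-1.
  by have := mgf_ge1D u Ai; rewrite uP.
have MV : M^-1 <= (1 + b * s)^-1 by rewrite lef_pV2 ?posrE//; lra.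
have u0 : u <= 0.
  rewrite -(pmulr_rle0 _ a0); suff : (1 + b * s)^-1 <= 1 by lra.
  by rewrite invf_le1; lra.
have [sG2|sG2] := leP s (G / 2).
  by rewrite le_max; apply/orP; left; lra.
have [sG|sG] := leP s G; rewrite !le_max; apply/orP; right; apply/orP.
  left; suff : u <= - r by lra.
  rewrite -mulNr ler_pdivlMr// mulrC.
  suff : (1 + b * s)^-1 <= (1 + b * (G / 2))^-1 by lra.
  by rewrite lef_pV2 ?posrE ?lerD2l ?ler_pM2l//; lra.
right; suff : u < - s by lra.
(* If - s <= u, then Phi_A(-s) <= Phi_A(u) = 1 / Phi_B(s), contradicting [GP]. *)
rewrite ltNge; apply/negP => su.
have := GP _ sG; rewrite MB// -/M ltNge => /negP; apply.
have := le_mgf A0 (measurable_itg Ai) su.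
rewrite uP (mgf_laplace A0 Ai) ?oppr_le0// -EFinM !lee_fin => h.
by rewrite -ler_pdivlMr// mul1r.
Qed.

End decay_rates.

(** Treats finite and infinite limits at once, as the right endpoint of B may be infinite. *)
Lemma cvge_from_below (R : realType) (I : Type) (F : set_system I)
    (FF : Filter F) (f : I -> \bar R) (l : \bar R) :
  (\forall i \near F, (f i <= l)%E) ->
  (forall z : R, (z%:E < l)%E -> \forall i \near F, (z%:E <= f i)%E) ->
  f @ F --> l.
Proof.
case: l => [r| |] fl lf.
- apply/fine_cvgP.
  have rfin : \forall i \near F, f i \is a fin_num.
    have h : ((r - 1)%:E < r%:E)%E by rewrite lte_fin; lra.
    apply: filterS2 fl (lf _ h) => i h1 h2.
    by rewrite fin_numElt (lt_le_trans (ltNyr _) h2) (le_lt_trans h1 (ltry _)).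
  split=> //; apply/cvgrPdist_le => e e0.
  have h : ((r - e)%:E < r%:E)%E by rewrite lte_fin; lra.
  apply: filterS3 fl (lf _ h) rfin => i h1 h2 /fineK /=.
  move: (fine _) => x xE; rewrite -xE !lee_fin in h1 h2.
  by rewrite ger0_norm; lra.
- by apply/cvgeyPge => z; apply: lf; rewrite ltry.
- by apply/cvgeNyPle => z; apply: filterS fl => i; rewrite leeNy_eq => /eqP ->; rewrite leNye.
Qed.

(** * From the load to the mean inter-arrival time *)

Section load_limit.
Context d (T : measurableType d) (R : realType) (P : probability T R).
Local Notation itg f := (P.-integrable setT (EFin \o f)).

(** E A = +oo would give load 0, below the lower bound, and E A = 0 would give load +oo, above 1. In
    the remaining case the bounds on b / a invert. *)
Lemma load_between (A B : {RV P >-> R}) (e : R) :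
  {ae P, forall w, 0 <= A w} -> itg B -> 0 < \int[P]_w B w -> 0 < e ->
  (load P A B < 1)%E ->
  ((\int[P]_w B w / (\int[P]_w B w + e))%:E < load P A B)%E ->
  itg A /\ \int[P]_w B w < \int[P]_w A w < \int[P]_w B w + e.
Proof.
move=> A0 Bi; rewrite /load unlock -(EFin_Rintegral Bi).
set b := \int[P]_w B w => b0 e0.
have AE : (\int[P]_w (A w)%:E = \int[P]_w `|(A w)%:E|)%E.
  apply: ae_eq_integral => //.
  - exact/measurable_EFinP.
  - by apply: measurableT_comp => //; exact/measurable_EFinP.
  - by apply: filterS A0 => w h _ /=; rewrite ger0_norm.
have EA0 : (0 <= \int[P]_w (A w)%:E)%E by rewrite AE integral_ge0.
have [Afin|] := ltP (\int[P]_w (A w)%:E)%E +oo%E; last first.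
  rewrite leye_eq => /eqP ->; rewrite invey mule0 => _.
  by rewrite lte_fin ltNge divr_ge0// ?addr_ge0// ltW.
have Ai : itg A.
  by apply/integrableP; split; [exact/measurable_EFinP|rewrite -AE].
move: EA0; rewrite -(EFin_Rintegral Ai); set a := \int[P]_w A w.
rewrite lee_fin inver; have [->|an0 a_ge0] := eqVneq a 0.
  by rewrite gt0_muley.
have a0 : 0 < a by rewrite lt_neqAle eq_sym an0.
rewrite -EFinM !lte_fin ltr_pdivrMr// mul1r => ba.
rewrite ltr_pM2l// ltf_pV2 ?posrE//; last lra.
by move=> ->; rewrite ba.
Qed.

End load_limit.
Unset Implicit Arguments.
Local Open Scope ereal_scope.

(** * Convergence of [y_star] to the right endpoint *)

Theorem proposition6p2 (R : realType) (d : measure_display)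
    (T : measurableType d) (P : probability T R)
    (I : Type) (F : set_system I) (FF : Filter F)
    (A : I -> {RV P >-> R}) (B : {RV P >-> R})
    (A_ge0 : forall i, {ae P, forall w, (0 <= A i w)%R})
    (B_ge0 : {ae P, forall w, (0 <= B w)%R})
    (AB_indep : forall i, independent_rv P (A i) B)
    (B_light : light_tailed P B)
    (B_density : has_density P B)
    (load_lt1 : forall i, load P (A i) B < 1)
    (BA_gt0 : forall i, 0 < P [set w | (A i w < B w)%R])
    (load_to1 : load P (A i) B @[i --> F] --> (1 : \bar R)) :
  y_star P (A i) B @[i --> F] --> right_endpoint P B.
Proof.
have mB : measurable_fun setT B by [].
have Bi := light_tailed_integrable B_ge0 mB B_light.
have [t bt Pt] := atomless_above_mean mB Bi (fun c => density_atomless c B_density).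
set b := (\int[P]_w B w)%R in bt.
have t0 : (0 <= (0 : R) < t)%R.
  by rewrite lexx (le_lt_trans _ bt)// ae_Rintegral_ge0.
have b0 : (0 < b)%R.
  (* Truncating at level 0 strictly lowers the mean of B, and the truncated mean is nonnegative. *)
  apply: le_lt_trans (Rintegral_truncated_lt B_ge0 mB Bi t0 Pt).
  have trunc0 := truncated_bounded B_ge0 (lexx (0%R : R)).
  apply: ae_Rintegral_ge0.
    by apply: filterS trunc0 => w /andP[].
  exact: integrable_bounded (measurable_truncated mB 0%R) trunc0.
have near_load (e : R) : (0 < e)%R -> \forall i \near F,
    P.-integrable setT (EFin \o A i) /\ (b < \int[P]_w A i w < b + e)%R.
  move=> e0; have be : ((b / (b + e))%:E < 1)%E.
    by rewrite lte_fin ltr_pdivrMr ?mul1r ?ltrDl// addr_gt0.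
  have : \forall i \near F, (b / (b + e))%:E < load P (A i) B.
    exact: load_to1 (open_ereal_gt' be).
  apply: filterS => i /= li.
  exact: load_between (A_ge0 i) Bi b0 e0 (load_lt1 i) li.
have tB : (t%:E <= right_endpoint P B)%E by apply: ereal_sup_ubound; exists t.
apply: cvge_from_below.
- pose h := ((t - b) / 2)%R.
  have h0 : (0 < h)%R by rewrite divr_gt0// subr_gt0.
  apply: filterS (near_load h h0) => i [Ai /andP[ba abh]].
  apply: ge_ereal_sup => _ [y /= yP <-].
  rewrite leNgt; apply/negP => By.
  have : right_endpoint P B \is a fin_num.
    by rewrite fin_numElt (lt_le_trans (ltNyr _) tB) (lt_trans By (ltry _)).
  move=> /fineK; move: (fine _) => r rE.
  rewrite -rE lte_fin in By; rewrite -rE lee_fin in tB.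
  have y0 : (0 <= y)%R by lra.
  (* The midpoint of r and y lies strictly above the endpoint, so B exceeds it with probability 0;
     it also makes the inequality B < y strict. *)
  have Bly : {ae P, forall w, (B w < y)%R}.
    exists [set w | ((r + y) / 2 < B w)%R]; split.
    + exact: measurable_gt.
    + apply/eqP; rewrite eq_le measure_ge0 andbT leNgt; apply/negP => Pr.
      have : (((r + y) / 2)%:E <= right_endpoint P B)%E.
        by apply: ereal_sup_ubound; exists ((r + y) / 2)%R.
      by rewrite -rE lee_fin; lra.
    + by move=> w /= /negP; rewrite -leNgt; lra.
  have truncE : 'M_P (truncated B y) = 'M_P B.
    apply/funext => s; apply: ae_eq_mgf => //; first exact: measurable_truncated.
    by apply: filterS Bly => w; rewrite /truncated => ->.
  have : (gamma_p P (A i) B < gamma_w P (A i) B)%E.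
    apply: (@gamma_p_lt_gamma_w _ _ _ P B B_ge0 Bi (A i) y
      (h ^+ 2 / 4 * fine (P [set w | (t < B w)%R]))%R) => //.
    + by apply: filterS2 B_ge0 Bly => w -> /ltW ->.
    + rewrite mulr_gt0 ?divr_gt0 ?exprn_gt0// fine_gt0// Pt/=.
      by rewrite (le_lt_trans (probability_le1 _ _)) ?ltry//; exact: measurable_gt.
    + move=> g g0; apply: gamma_w_elt_le => //; first exact: ltW.
      by rewrite /h in abh *; lra.
  rewrite ltNge => /negP; apply; apply: le_trans yP _.
  by rewrite /gamma_p truncE.
- move=> z /ereal_sup_gt[_ [x Px <-]]; rewrite lte_fin => zx.
  (* The given x may be negative; t then serves instead, since a positive point is needed to
     truncate below it. *)
  have [x' zx' [x'0 Px']] : exists2 x', (z < x')%R &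
      (0 < x')%R /\ 0 < P [set w | (x' < B w)%R].
    have [tx|xt] := leP t x; last by exists t; [exact: lt_trans xt|case/andP: t0].
    by exists x => //; split => //; case/andP: t0 => _ /lt_le_trans; apply.
  (* The truncation level must be nonnegative, while z is an arbitrary real below the endpoint. *)
  pose y := Num.max z 0%R.
  have y0 : (0 <= y)%R by rewrite le_max lexx orbT.
  have yx : (0 <= y < x')%R by rewrite y0 gt_max zx'.
  have [e e0 He] := gamma_w_le_gamma_p B_ge0 Bi (measurable_truncated mB y) y0
    (truncated_bounded B_ge0 y0) (Rintegral_truncated_lt B_ge0 mB Bi yx Px') bt Pt.
  apply: filterS (near_load e e0) => i [Ai ab].
  apply: (@le_trans _ _ y%:E); first by rewrite lee_fin le_max lexx.
  by apply: ereal_sup_ubound; exists y => //; exact: He.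
Qed.
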